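(* Let $G_3$ be the Gupta-Sidki $3$-group and, for $m\ge 0$, let $St_{G_3}(m)$ be its $m$-th level stabilizer subgroup. For $n\ge 1$ set $G^{(n)}=G_3/St_{G_3}(n+3)$. Then for every $n\geq 1$ the action of $\operatorname{Aut} F_2$ on $\operatorname{Epi}(F_2,G^{(n)})$ is not transitive.
   Context: Rooted tree. Let $X=\{1,2,3\}$. The regular ternary rooted tree $T_3$ has as vertices all finite sequences over $X$; two sequences are joined by an edge when one is obtained from the other by appending one letter on the right; the root is the empty sequence. $\operatorname{Aut} T_3$ is the group of bijections of the vertex set preserving the root and adjacency. Gupta-Sidki $3$-group. Let $\pi=(1,2,3)$ be the cyclic permutation of $X$. Define $x,y\in\operatorname{Aut} T_3$ (both fix the root) by, for $s\in X$ and $\sigma$ a vertex of $T_3$: $x(s\sigma)=\pi(s)\sigma$, and, recursively, $y(1\sigma)=1\,x(\sigma)$, $y(2\sigma)=2\,x^{-1}(\sigma)$, $y(3\sigma)=3\,y(\sigma)$. The Gupta-Sidki $3$-group is $G_3=\langle x,y\rangle\le\operatorname{Aut} T_3$. Level stabilizers. $St_{G_3}(m)$ is the subgroup of all $g\in G_3$ fixing every sequence of length $m$ over $X$; it is a normal subgroup of finite index in $G_3$. Action. For a group $G$ generated by $2$ elements, $\operatorname{Epi}(F_2,G)$ is the set of epimorphisms from the free group $F_2$ of rank $2$ onto $G$ (identified with the set of generating pairs of $G$ via the images of a fixed basis of $F_2$). The group $\operatorname{Aut} F_2$ acts on it by $\phi^{\tau}=\phi\circ\tau^{-1}$. *)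

(* Defs.v *)
From HB Require Import structures.
From mathcomp Require Import all_boot boolp.

Set Implicit Arguments.
Unset Strict Implicit.
Unset Printing Implicit Defensive.

Local Open Scope group_scope.
Local Open Scope quotient_scope.

Section FreeGroup.
Variable I : choiceType.

(* The free group on I: reduced words, multiplied by concatenating and then
   cancelling.  The letter (i, true) is the basis element i, (i, false) its
   inverse; free_lift and free_lift_gen give the universal property. *)
Definition letter := (I * bool)%type.
Definition letter_inv (a : letter) : letter := (a.1, ~~ a.2).

Definition reduced (w : seq letter) : bool :=
  sorted (fun a b => b != letter_inv a) w.

Definition word_cons (a : letter) (w : seq letter) : seq letter :=
  if w is b :: w' then if b == letter_inv a then w' else a :: w else [:: a].

Definition word_mul (u v : seq letter) : seq letter := foldr word_cons v u.
Definition word_inv (u : seq letter) : seq letter := rev (map letter_inv u).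

Record free_group := FreeGroup { word : seq letter; _ : reduced word }.

HB.instance Definition _ := [isSub for word].
HB.instance Definition _ := [Choice of free_group by <:].

Lemma letter_invK : involutive letter_inv.
Proof. by case=> i b; rewrite /letter_inv /= negbK. Qed.

Lemma reduced_cons a w : reduced w -> reduced (word_cons a w).
Proof.
case: w => [//|b w]; rewrite /word_cons /reduced.
by case: eqP => [_ /path_sorted //|/eqP ab /= ->]; rewrite ab.
Qed.

Lemma reduced_mul u v : reduced v -> reduced (word_mul u v).
Proof. by move=> rv; elim: u => //= a u; apply: reduced_cons. Qed.

Lemma word_consK a w : reduced w ->
  word_cons (letter_inv a) (word_cons a w) = w.
Proof.
case: w => [_|b w] /=; first by rewrite letter_invK eqxx.
case: eqP => [-> |_ _] /=; last by rewrite letter_invK eqxx.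
by case: w => [//|c w] /= /andP[/negPf]; rewrite letter_invK => ->.
Qed.

Lemma word_mul_cons a u w : reduced u -> reduced w ->
  word_mul (word_cons a u) w = word_cons a (word_mul u w).
Proof.
case: u => [//|b u] ru rw /=; case: eqP => [-> /=|//].
by have := word_consK (letter_inv a) (reduced_mul u rw); rewrite letter_invK.
Qed.

Lemma word_mulA u v w : reduced v -> reduced w ->
  word_mul u (word_mul v w) = word_mul (word_mul u v) w.
Proof.
move=> rv rw; elim: u => //= a u ->.
by rewrite word_mul_cons // reduced_mul.
Qed.

Lemma word_mul1 u : reduced u -> word_mul u [::] = u.
Proof.
elim: u => //= a u IHu ru; rewrite (IHu (path_sorted ru)).
by case: u ru {IHu} => [//|b u] /= /andP[/negPf->].
Qed.

Lemma word_mulV u : reduced u -> word_mul (word_inv u) u = [::].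
Proof.
elim: u => //= a u IHu ru; have ru' := path_sorted ru.
rewrite /word_inv /= rev_cons /word_mul foldr_rcons /= letter_invK eqxx.
exact: IHu.
Qed.

Lemma reduced_inv u : reduced u -> reduced (word_inv u).
Proof.
rewrite /reduced /word_inv rev_sorted sorted_map; apply: sub_sorted => a b /=.
by apply: contraNneq => ->; rewrite letter_invK.
Qed.

Lemma word_invK u : word_inv (word_inv u) = u.
Proof.
rewrite /word_inv map_rev revK -map_comp -[RHS]map_id.
by apply: eq_map => a /=; rewrite letter_invK.
Qed.

Lemma word_reduced (w : free_group) : reduced (word w).
Proof. by case: w. Qed.

Definition free_one : free_group := @FreeGroup [::] isT.
Definition free_mul (u v : free_group) : free_group :=
  FreeGroup (reduced_mul (word u) (word_reduced v)).
Definition free_inv (u : free_group) : free_group :=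
  FreeGroup (reduced_inv (word_reduced u)).

Lemma free_mulA : associative free_mul.
Proof.
by move=> u v w; apply: val_inj; apply: word_mulA; apply: word_reduced.
Qed.
Lemma free_mul1 : left_id free_one free_mul.
Proof. by move=> u; apply: val_inj. Qed.
Lemma free_1mul : right_id free_one free_mul.
Proof. by move=> u; apply: val_inj; apply/word_mul1/word_reduced. Qed.
Lemma free_mulV : left_inverse free_one free_inv free_mul.
Proof. by move=> u; apply: val_inj; apply/word_mulV/word_reduced. Qed.
Lemma free_Vmul : right_inverse free_one free_inv free_mul.
Proof.
move=> u; apply: val_inj; rewrite /= -{1}[word u]word_invK.
exact/word_mulV/reduced_inv/word_reduced.
Qed.

HB.instance Definition _ :=
  isGroup.Build free_group free_mulA free_mul1 free_1mul free_mulV free_Vmul.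

Definition free_gen (i : I) : free_group := @FreeGroup [:: (i, true)] isT.

Section UniversalProperty.
Variables (H : groupType) (f : I -> H).

Definition letter_eval (a : letter) : H := if a.2 then f a.1 else (f a.1)^-1.
Definition free_lift (u : free_group) : H := \prod_(a <- word u) letter_eval a.

Lemma free_liftM : {morph free_lift : u v / u * v}.
Proof.
move=> u v; rewrite /free_lift /=.
elim: (word u) => [|a w IHw] /=; first by rewrite big_nil mul1g.
rewrite big_cons -mulgA -{}IHw.
case: (word_mul w _) => [|b t] /=; first by rewrite big_cons.
case: eqP => [->|_]; rewrite !big_cons //.
by case: a => i [] /=; rewrite /letter_eval /= mulgA ?mulgV ?mulVg mul1g.
Qed.

HB.instance Definition _ :=
  isMultiplicative.Build free_group H free_lift free_liftM.

Lemma free_lift_gen i : free_lift (free_gen i) = f i.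
Proof. by rewrite /free_lift big_seq1. Qed.

End UniversalProperty.

End FreeGroup.

Definition F2 : groupType := free_group 'I_2.

Section Generated.
Variables (G : groupType) (S : {pred G}).

Definition generated : {pred G} := fun g =>
  `[< forall H : {pred G}, group_closed H -> {subset S <= H} -> g \in H >].

Lemma generated_closed : group_closed generated.
Proof.
split=> [|g h /asboolP gP /asboolP hP]; apply/asboolP => H HG SH.
  exact: HG.1.
by apply: HG.2; [apply: gP | apply: hP].
Qed.

End Generated.

Record normal_subgroup (G : groupType) := NormalSubgroup {
  nsub_pred :> {pred G};
  nsub_group : group_closed nsub_pred;
  nsub_conj : forall g h : G, h \in nsub_pred -> h ^ g \in nsub_pred
}.

Section Quotient.
Variables (G : groupType) (N : normal_subgroup G).

Definition coset_rel : rel G := fun g h => g^-1 * h \in nsub_pred N.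

Lemma coset_relP : equiv_class_of coset_rel.
Proof.
have [N1 ND] := nsub_group N.
have NV := group_closedV (nsub_group N).
have NM := group_closedM (nsub_group N).
split=> [g|g h|h g k gh hk]; rewrite /coset_rel.
- by rewrite mulVg.
- by apply/idP/idP => /NV; rewrite invgM invgK.
- by rewrite -[k](mulVKg h) mulgA NM.
Qed.

Canonical coset_equiv : equiv_rel G := EquivRelPack coset_relP.

Definition quotient_group := {eq_quot coset_equiv}.

HB.instance Definition _ := Choice.on quotient_group.
HB.instance Definition _ := EqQuotient.on quotient_group.

Definition quot_one : quotient_group := lift_cst quotient_group 1.
Definition quot_inv := lift_op1 quotient_group (@inv G).
Definition quot_mul := lift_op2 quotient_group (@mul G).

Lemma repr_coset g : coset_rel g (repr (\pi_quotient_group g)).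
Proof.
by apply/(@eqmodP _ coset_equiv); rewrite reprK.
Qed.

Lemma pi_quot_inv : {morph \pi_quotient_group : g / g^-1 >-> quot_inv g}.
Proof.
move=> g; unlock quot_inv; apply/eqmodP => /=; rewrite /coset_rel invgK.
have := group_closedV (nsub_group N) (repr_coset g); rewrite invgM invgK.
by move/(nsub_conj g^-1); rewrite conjgE invgK mulgK.
Qed.
Canonical pi_quot_inv_morph := PiMorph1 pi_quot_inv.

Lemma pi_quot_mul :
  {morph \pi_quotient_group : g h / g * h >-> quot_mul g h}.
Proof.
move=> g h; unlock quot_mul; apply/eqmodP => /=; rewrite /coset_rel.
have := group_closedM (nsub_group N) (nsub_conj h (repr_coset g)) (repr_coset h).
by rewrite conjgE invgM !mulgA mulgK.
Qed.
Canonical pi_quot_mul_morph := PiMorph2 pi_quot_mul.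

Canonical pi_quot_one_morph := PiConst quot_one.

Lemma quot_mulA : associative quot_mul.
Proof.
elim/quotW=> f; elim/quotW=> g; elim/quotW=> h.
by rewrite -!pi_quot_mul mulgA.
Qed.
Lemma quot_mul1 : left_id quot_one quot_mul.
Proof. by elim/quotW=> g; rewrite !piE mul1g. Qed.
Lemma quot_1mul : right_id quot_one quot_mul.
Proof. by elim/quotW=> g; rewrite !piE mulg1. Qed.
Lemma quot_mulV : left_inverse quot_one quot_inv quot_mul.
Proof. by elim/quotW=> g; rewrite !piE mulVg. Qed.
Lemma quot_Vmul : right_inverse quot_one quot_inv quot_mul.
Proof. by elim/quotW=> g; rewrite !piE mulgV. Qed.

HB.instance Definition _ := isGroup.Build quotient_group
  quot_mulA quot_mul1 quot_1mul quot_mulV quot_Vmul.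

End Quotient.

(* The inverse map is stored so that the action below needs no choice; it is
   determined by aut_fun. *)
Record automorphism (G : groupType) := Automorphism {
  aut_fun :> {multiplicative G -> G};
  aut_inv : {multiplicative G -> G};
  autK : cancel aut_fun aut_inv;
  aut_invK : cancel aut_inv aut_fun
}.

Record Epi (F G : groupType) := EpiOf {
  epi_fun :> {multiplicative F -> G};
  epi_surj : forall g : G, exists w : F, epi_fun w = g
}.

Section EpiAction.
Variables (F G : groupType) (phi : Epi F G) (tau : automorphism F).

Definition epi_act_fun (w : F) : G := phi (aut_inv tau w).

Lemma epi_act_funM : {morph epi_act_fun : u v / u * v}.
Proof. by move=> u v; rewrite /epi_act_fun !gmulfM. Qed.

HB.instance Definition _ := isMultiplicative.Build F G epi_act_fun epi_act_funM.

Lemma epi_act_surj (g : G) : exists w : F, epi_act_fun w = g.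
Proof.
have [w <-] := epi_surj phi g.
by exists (tau w); rewrite /epi_act_fun autK.
Qed.

Definition epi_act : Epi F G := @EpiOf F G epi_act_fun epi_act_surj.

End EpiAction.

Definition Epi_transitive (F G : groupType) : Prop :=
  forall phi psi : Epi F G,
    exists tau : automorphism F, epi_act phi tau =1 psi.

(* The letters 1, 2, 3 of the alphabet are the ordinals 0, 1, 2. *)
Definition alphabet := 'I_3.
Definition vertex := seq alphabet.

Definition adjacent (u v : vertex) : Prop :=
  exists s : alphabet, v = rcons u s \/ u = rcons v s.

Definition is_tree_aut (g : vertex -> vertex) : Prop :=
  [/\ bijective g, g [::] = [::] &
      forall u v, adjacent (g u) (g v) <-> adjacent u v].

Record tree_aut := TreeAut {
  tree_fun :> vertex -> vertex;
  _ : `[< is_tree_aut tree_fun >]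
}.

HB.instance Definition _ := [isSub for tree_fun].
HB.instance Definition _ := [Choice of tree_aut by <:].

Lemma tree_autP (g : tree_aut) : is_tree_aut g.
Proof. by case: g => f /= /asboolP. Qed.

Lemma tree_aut_eq (g h : tree_aut) : g =1 h -> g = h.
Proof. by move=> gh; apply/val_inj/funext. Qed.

Lemma is_tree_aut_id : is_tree_aut id.
Proof. by split=> //; exists id. Qed.

Lemma is_tree_aut_comp f g :
  is_tree_aut f -> is_tree_aut g -> is_tree_aut (f \o g).
Proof.
move=> [bf f0 fa] [bg g0 ga]; split; first exact: bij_comp.
  by rewrite /= g0.
by move=> u v /=; rewrite fa ga.
Qed.

Lemma tree_aut_surj (g : tree_aut) (v : vertex) : exists u, g u == v.
Proof. by have [[h _ hK] _ _] := tree_autP g; exists (h v); apply/eqP. Qed.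

Definition tree_inv_fun (g : tree_aut) (v : vertex) : vertex :=
  xchoose (tree_aut_surj g v).

Lemma tree_inv_funK g : cancel (tree_inv_fun g) g.
Proof. by move=> v; apply/eqP/(xchooseP (tree_aut_surj g v)). Qed.

Lemma tree_funK (g : tree_aut) : cancel g (tree_inv_fun g).
Proof.
have [bg _ _] := tree_autP g.
by move=> v; apply: (bij_inj bg); rewrite tree_inv_funK.
Qed.

Lemma is_tree_aut_inv g : is_tree_aut (tree_inv_fun g).
Proof.
have [bg g0 ga] := tree_autP g; split.
- by exists g; [apply: tree_inv_funK | apply: tree_funK].
- by rewrite -{1}g0 tree_funK.
- by move=> u v; rewrite -ga !tree_inv_funK.
Qed.

(* Products act on the left: (g * h) v = g (h v). *)
Definition tree_one : tree_aut := TreeAut (asboolT is_tree_aut_id).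
Definition tree_mul (g h : tree_aut) : tree_aut :=
  TreeAut (asboolT (is_tree_aut_comp (tree_autP g) (tree_autP h))).
Definition tree_inv (g : tree_aut) : tree_aut :=
  TreeAut (asboolT (is_tree_aut_inv g)).

Lemma tree_mulA : associative tree_mul.
Proof. by move=> f g h; apply: tree_aut_eq. Qed.
Lemma tree_mul1 : left_id tree_one tree_mul.
Proof. by move=> g; apply: tree_aut_eq. Qed.
Lemma tree_1mul : right_id tree_one tree_mul.
Proof. by move=> g; apply: tree_aut_eq. Qed.
Lemma tree_mulV : left_inverse tree_one tree_inv tree_mul.
Proof. by move=> g; apply: tree_aut_eq => v; apply: tree_funK. Qed.
Lemma tree_Vmul : right_inverse tree_one tree_inv tree_mul.
Proof. by move=> g; apply: tree_aut_eq => v; apply: tree_inv_funK. Qed.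

HB.instance Definition _ :=
  isGroup.Build tree_aut tree_mulA tree_mul1 tree_1mul tree_mulV tree_Vmul.

Definition gs_pi : alphabet -> alphabet := @ordS 3.

Definition gs_x_fun (v : vertex) : vertex :=
  if v is s :: sigma then gs_pi s :: sigma else [::].

Lemma is_tree_aut_intro (f g : vertex -> vertex) :
  cancel f g -> cancel g f -> f [::] = [::] ->
  (forall u s, exists t, f (rcons u s) = rcons (f u) t) -> is_tree_aut f.
Proof.
move=> fK gK f0 fr; split=> //; first by exists g.
have down u v s : f v = rcons (f u) s -> exists t, v = rcons u t.
  case/lastP: v => [|v t]; first by rewrite f0 => /(congr1 size); rewrite size_rcons.
  have [t' ->] := fr v t => /rcons_inj[/(can_inj fK) -> _].
  by exists t.
move=> u v; split=> [[s [/down|/down] [t ->]]|[s [->|->]]].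
- by exists t; left.
- by exists t; right.
- by have [t ->] := fr u s; exists t; left.
- by have [t ->] := fr v s; exists t; right.
Qed.

Definition gs_xV_fun (v : vertex) : vertex :=
  if v is s :: sigma then ord_pred s :: sigma else [::].

Lemma gs_x_funK : cancel gs_x_fun gs_xV_fun.
Proof. by case=> //= s v; rewrite ordSK. Qed.

Lemma gs_xV_funK : cancel gs_xV_fun gs_x_fun.
Proof. by case=> //= s v; rewrite /gs_pi ord_predK. Qed.

Lemma gs_x_rcons u s : exists t, gs_x_fun (rcons u s) = rcons (gs_x_fun u) t.
Proof. by case: u => [|a u]; [exists (gs_pi s) | exists s]. Qed.

Lemma gs_xV_rcons u s : exists t, gs_xV_fun (rcons u s) = rcons (gs_xV_fun u) t.
Proof. by case: u => [|a u]; [exists (ord_pred s) | exists s]. Qed.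

Lemma gs_x_subproof : is_tree_aut gs_x_fun.
Proof. exact: is_tree_aut_intro gs_x_funK gs_xV_funK erefl gs_x_rcons. Qed.

Definition gs_x : tree_aut := TreeAut (asboolT gs_x_subproof).

Fixpoint gs_y_fun (v : vertex) : vertex :=
  if v is s :: sigma then
    s :: match val s with
         | 0 => gs_x sigma
         | 1 => gs_x^-1 sigma
         | _ => gs_y_fun sigma
         end
  else [::].

Fixpoint gs_yV_fun (v : vertex) : vertex :=
  if v is s :: sigma then
    s :: match val s with
         | 0 => gs_x^-1 sigma
         | 1 => gs_x sigma
         | _ => gs_yV_fun sigma
         end
  else [::].

Lemma gs_xVE v : tree_inv_fun gs_x v = gs_xV_fun v.
Proof. by rewrite -{1}[v]gs_xV_funK; apply: tree_funK. Qed.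

Lemma gs_y_funK : cancel gs_y_fun gs_yV_fun.
Proof.
elim=> //= s v IHv; congr (_ :: _); case: (val s) => [|[|n]] //.
  exact: tree_funK.
exact: (tree_inv_funK gs_x).
Qed.

Lemma gs_yV_funK : cancel gs_yV_fun gs_y_fun.
Proof.
elim=> //= s v IHv; congr (_ :: _); case: (val s) => [|[|n]] //.
  exact: (tree_inv_funK gs_x).
exact: tree_funK.
Qed.

Lemma gs_y_rcons u s : exists t, gs_y_fun (rcons u s) = rcons (gs_y_fun u) t.
Proof.
elim: u => [|a u [t IHu]] /=.
  by exists s; case: (val s) => [|[|n]] //; rewrite gs_xVE.
case: (val a) => [|[|n]].
- by have [t' ->] := gs_x_rcons u s; exists t'.
- by rewrite !gs_xVE; have [t' ->] := gs_xV_rcons u s; exists t'.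
- by exists t; rewrite IHu.
Qed.

Lemma gs_y_subproof : is_tree_aut gs_y_fun.
Proof. exact: is_tree_aut_intro gs_y_funK gs_yV_funK erefl gs_y_rcons. Qed.

Definition gs_y : tree_aut := TreeAut (asboolT gs_y_subproof).

Definition gs_pred : {pred tree_aut} := generated (pred2 gs_x gs_y).

Definition gupta_sidki := {g : tree_aut | gs_pred g}.

HB.instance Definition _ := Choice.on gupta_sidki.
HB.instance Definition _ := SubType.on gupta_sidki.
HB.instance Definition _ := SubChoice_isSubGroup.Build
  tree_aut gs_pred gupta_sidki (generated_closed (pred2 gs_x gs_y)).

Definition level_stab_pred (m : nat) : {pred gupta_sidki} :=
  fun g => [forall w : m.-tuple alphabet, val g w == w].

Lemma level_stab_group m : group_closed (level_stab_pred m).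
Proof.
split=> [|g h /forallP gP /forallP hP]; apply/forallP => w //=.
have /eqP hw := hP w; have /eqP gw := gP w.
by apply/eqP; rewrite -[in LHS]hw /= tree_funK.
Qed.

Lemma size_tree_aut (g : tree_aut) (v : vertex) : size (g v) = size v.
Proof.
have [bg g0 ga] := tree_autP g; have [n] := ubnP (size v).
elim: n v => // n IHn; elim/last_ind=> [|u s _]; first by rewrite g0.
rewrite size_rcons ltnS => lt_un.
have : adjacent (g u) (g (rcons u s)) by apply/ga; exists s; left.
case=> t [->|gu]; first by rewrite size_rcons IHn.
case/lastP: u lt_un gu => [|u r] lt_un gu.
  by move/(congr1 size): gu; rewrite g0 size_rcons.
have sg : size (g (rcons u r)) = (size u).+1 by rewrite IHn // size_rcons.
have : adjacent (g u) (g (rcons u r)) by apply/ga; exists r; left.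
have su : size (g u) = size u.
  by apply: IHn; apply: leq_trans lt_un; rewrite size_rcons.
case=> q [|gu']; last first.
  by move/(congr1 size): gu'; rewrite su size_rcons sg => /eqP; rewrite ltn_eqF // ltnW.
rewrite gu => /rcons_inj[/(bij_inj bg) /(congr1 size)].
by rewrite !size_rcons => /eqP; rewrite gtn_eqF // ltnW.
Qed.

Lemma level_stab_conj m (g h : gupta_sidki) :
  h \in level_stab_pred m -> h ^ g \in level_stab_pred m.
Proof.
move=> /forallP hP; apply/forallP => w; apply/eqP => /=.
have sw : size (val g w) == m by rewrite size_tree_aut size_tuple.
have /eqP /= hw := hP (Tuple sw).
by rewrite hw tree_funK.
Qed.

Definition St (m : nat) : normal_subgroup gupta_sidki :=
  NormalSubgroup (@level_stab_group m) (@level_stab_conj m).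

(* Main.v *)
Require Import Defs.
From HB Require Import structures.
From mathcomp Require Import all_boot boolp.
From mathcomp Require Import all_order all_algebra ring.

Set Implicit Arguments.
Unset Strict Implicit.
Unset Printing Implicit Defensive.

Import Order.TTheory GRing.Theory Num.Theory.

(** Let a, b be the basis of the free group F2 and c = [~ a, b].  If an
automorphism of F2 carries one generating pair to another, it carries one value
of c to the other, so it suffices to find two generating pairs of G_3 whose
commutators cannot be matched by an automorphism; the action on words of
length three is enough to see this.

What automorphisms do to c.  Every commutator of F2 is a product of conjugates
of c and its inverse, so for an automorphism sigma we may write
sigma c = prod_k (c^(e_k))^(u_k) with signs e_k.  Modulo the second derived
subgroup this says that sigma c is D c, where D = sum_k e_k X^(i_k) Y^(j_k) is
a Laurent polynomial and (i_k, j_k) are the exponents of u_k.  Since sigma is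
invertible, D is a unit, hence a monomial up to a scalar, and the distribution
of the points (i_k, j_k) with signed weights e_k has no covariance:
(sum e_k) (sum e_k i_k j_k) = (sum e_k i_k) (sum e_k j_k)
(automorphism_moments).  It is enough to know that the images of D in one
variable under X = T^p, Y = T^q are monomials, and these are obtained from the
representations of F2 by affine maps z |-> T^n z + f over the field of rational
functions in T: there c acts by a translation, and the translation parts of c
and sigma c divide each other over the Laurent polynomials.

What G_3 sees.  On words of length three an element of the derived subgroup has
four coordinates n0, n1, n2, n3 in F_3, additive in the element; conjugation by
x adds n0 to n1 and n2 to n3, conjugation by y adds n0 to n2 and n1 to n3
(derived_coords).  In other words the derived subgroup of G_3 has the quotient
F_3[X, Y] / ((X - 1)^2, (Y - 1)^2), with its module structure.  Consequently the
coordinates of the value of sigma c at (x, y) are moments of the weights e_k, and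
the absence of covariance becomes n0 n3 = n1 n2.

The second pair.  Let t act on the tree by x on each of the three subtrees below
the root.  Conjugation by t^-1 fixes x and sends y to the product of y by an
explicit commutator in G_3, so it maps G_3 into itself; as t^3 = 1, it is an
automorphism of G_3, and (x, t y t^-1) generates G_3.  The commutator of this
pair has coordinates (-1, 0, 1, 1), for which n0 n3 and n1 n2 differ. *)

(** * Group morphisms *)

Section GroupMorphisms.
Local Open Scope group_scope.
Variables (G H : groupType) (f : {multiplicative G -> H}).

Lemma gmorph1 : f 1 = 1.
Proof. by apply: (mulgI (f 1)); rewrite -gmulfM !mulg1. Qed.

Lemma gmorphV : {morph f : g / g^-1}.
Proof. by move=> g; apply/esym/mulg1_eq; rewrite -gmulfM mulgV gmorph1. Qed.

Lemma gmorphJ : {morph f : g h / g ^ h}.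
Proof. by move=> g h; rewrite !gmulfM gmorphV. Qed.

Lemma gmorphR : {morph f : g h / [~ g, h]}.
Proof. by move=> g h; rewrite !commgEl gmulfM gmorphV gmorphJ. Qed.

Lemma gmorph_prod (I : Type) (r : seq I) (E : I -> G) :
  f (\prod_(i <- r) E i) = \prod_(i <- r) f (E i).
Proof. exact: (big_morph f (@gmulfM _ _ f) gmorph1). Qed.

End GroupMorphisms.

(** * Units of the Laurent polynomial ring *)

Section LaurentUnits.
Local Open Scope ring_scope.
Variable K : fieldType.

(** The operator X d/dX multiplies X^n by n, so the values of its iterates at 1
are the moments of the exponents. *)
Definition euler_op (p : {poly K}) : {poly K} := 'X * p^`().

Lemma euler_opE (I : Type) (r : seq I) (c : I -> K) (n : I -> nat) :
  euler_op (\sum_(k <- r) c k *: 'X^(n k)) =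
  \sum_(k <- r) (c k * (n k)%:R) *: 'X^(n k).
Proof.
rewrite /euler_op linear_sum mulr_sumr; apply: eq_bigr => k _.
rewrite /= derivZ derivXn -['X^_ *+ _]scaler_nat -!scalerAr scalerA.
by case: (n k) => [|m]; [rewrite mulr0 !scale0r | rewrite -exprS].
Qed.

Lemma horner1_sum (I : Type) (r : seq I) (c : I -> K) (n : I -> nat) :
  (\sum_(k <- r) c k *: 'X^(n k)).[1] = \sum_(k <- r) c k.
Proof.
rewrite horner_sum; apply: eq_bigr => k _.
by rewrite hornerZ hornerXn expr1n mulr1.
Qed.

Definition moment (I : Type) (r : seq I) (c : I -> K) (f : I -> int) : K :=
  \sum_(k <- r) c k * (f k)%:~R.

(** A divisor of a power of X is a monomial a X^d.  Evaluating it at 1, together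
with its first two images under X d/dX, gives a, a d and a d^2. *)
Lemma dvdXn_variance (I : Type) (r : seq I) (c : I -> K) (n : I -> nat)
    (q : {poly K}) (m : nat) :
  (\sum_(k <- r) c k *: 'X^(n k)) * q = 'X^m ->
  (\sum_(k <- r) c k) * (\sum_(k <- r) c k * (n k)%:R * (n k)%:R) =
  (\sum_(k <- r) c k * (n k)%:R) ^+ 2.
Proof.
set p := (X in X * q) => pq.
have /dvdp_exp_XsubCP [d [_]] : p %| ('X - 0%:P) ^+ m.
  by rewrite subr0 -pq dvdp_mulr.
rewrite subr0 => /eqpf_eq [a _ pE].
have pE' : p = \sum_(k <- [:: tt]) a *: 'X^d by rewrite big_seq1.
have := euler_opE r c n; rewrite -/p pE' euler_opE => p1.
have := euler_opE r (fun k => c k * (n k)%:R) n; rewrite -p1 euler_opE => p2.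
rewrite -(horner1_sum r c n) -/p pE' -(horner1_sum r _ n) -p2 !horner1_sum.
by rewrite -(horner1_sum r _ n) -p1 horner1_sum !big_seq1; ring.
Qed.

(** Laurent polynomials are handled inside the field of rational functions. *)
Notation L := {fraction {poly K}}.
Local Notation "p %:F" := (@tofrac {poly K} p).
Definition Tvar : L := ('X : {poly K})%:F.

Lemma Tvar_neq0 : Tvar != 0.
Proof. by rewrite /Tvar tofrac_eq0 polyX_eq0. Qed.

Definition laurent (I : Type) (r : seq I) (c : I -> K) (n : I -> int) : L :=
  \sum_(k <- r) ((c k)%:P)%:F * Tvar ^ n k.

Lemma laurent_shift (I : Type) (r : seq I) (c : I -> K) (n : I -> int) :
  exists (N : nat) (n' : I -> nat),
    laurent r c n * Tvar ^+ N = (\sum_(k <- r) c k *: 'X^(n' k))%:F /\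
    forall f : I -> K, \sum_(k <- r) f k * (n' k)%:R =
      \sum_(k <- r) f k * ((n k)%:~R + N%:R).
Proof.
have [N NP] : exists N : nat, all (fun k => 0 <= n k + N%:Z) r.
  elim: r => [|k r [N IHr]]; first by exists 0%N.
  exists (N + `|n k|)%N => /=; apply/andP; split.
    rewrite PoszD addrCA ler_wpDl // abszE.
    by rewrite -lerBlDl sub0r -normrN ler_norm.
  apply: sub_all IHr => i iP; rewrite PoszD addrA ler_wpDr //.
exists N, (fun k => absz (n k + N%:Z)).
elim: r NP => [|k r IHr] /=.
  by rewrite /laurent !big_nil mul0r tofrac0; split=> // f; rewrite !big_nil.
case/andP=> kP /IHr[IH1 IH2]; have kE := gez0_abs kP; split.
  rewrite /laurent !big_cons mulrDl -/(laurent r c n) IH1 tofracD; congr (_ + _).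
  rewrite -mul_polyC tofracM tofracXn -mulrA; congr (_ * _).
  by rewrite -/Tvar !exprnP kE expfzDr ?Tvar_neq0.
by move=> f; rewrite !big_cons IH2 [N%:R]pmulrn -intrD -kE.
Qed.

(** A unit of the ring of Laurent polynomials is a monomial: after clearing
denominators it divides a power of the variable.  Clearing denominators
translates the exponents by N, and the variance is translation invariant. *)
Lemma laurent_unit_variance (I J : Type) (r : seq I) (c : I -> K) (n : I -> int)
    (s : seq J) (d : J -> K) (m : J -> int) :
  laurent r c n * laurent s d m = 1 ->
  moment r c (fun=> 1) * moment r c (fun k => n k * n k) =
  moment r c n ^+ 2.
Proof.
have [N [n' [nE nS]]] := laurent_shift r c n.
have [M [m' [mE _]]] := laurent_shift s d m.
move=> rs1; have : (\sum_(k <- r) c k *: 'X^(n' k))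
    * (\sum_(k <- s) d k *: 'X^(m' k)) = 'X^(N + M) :> {poly K}.
  apply/eqP; rewrite -tofrac_eq tofracM -nE -mE tofracXn exprD.
  by rewrite mulrACA rs1 mul1r.
move/dvdXn_variance.
rewrite !nS; under [X in _ * X]eq_bigr => k _ do rewrite mulrAC.
rewrite nS /moment; set a := N%:R : K.
have -> : \sum_(k <- r) c k * ((n k)%:~R + a) =
    \sum_(k <- r) c k * (n k)%:~R + a * \sum_(k <- r) c k * 1%:~R.
  by rewrite mulr_sumr -big_split; apply: eq_bigr => k _ /=; ring.
have -> : \sum_(k <- r) c k * ((n k)%:~R + a) * ((n k)%:~R + a) =
    \sum_(k <- r) c k * (n k * n k)%:~R + a *+ 2 * \sum_(k <- r) c k * (n k)%:~R
    + a ^+ 2 * \sum_(k <- r) c k * 1%:~R.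
  rewrite !mulr_sumr -!big_split; apply: eq_bigr => k _ /=.
  by rewrite intrM; ring.
have -> : \sum_(k <- r) c k = \sum_(k <- r) c k * 1%:~R.
  by apply: eq_bigr => k _; rewrite mulr1.
set m0 := \sum_(k <- r) _ * 1; set m1 := \sum_(k <- r) _ * (n k)%:~R.
set m2 := \sum_(k <- r) _ => E.
apply: (addIr (m0 * (a *+ 2 * m1 + a ^+ 2 * m0))).
by rewrite -mulrDr addrA E; ring.
Qed.

End LaurentUnits.

(** * Commutators in the free group of rank two *)

Section ConjugateProducts.
Local Open Scope group_scope.
Variables (G : groupType) (c : G).

(** The flag of an entry tells whether c is inverted, and the group element
tells by what it is conjugated. *)
Definition conj_prod (l : seq (bool * G)) : G :=
  \prod_(k <- l) (if k.1 then c^-1 else c) ^ k.2.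

Definition is_conj_prod (g : G) : Prop := exists l, g = conj_prod l.

Lemma is_conj_prodM g h :
  is_conj_prod g -> is_conj_prod h -> is_conj_prod (g * h).
Proof. by case=> l -> [m ->]; exists (l ++ m); rewrite /conj_prod big_cat. Qed.

Lemma is_conj_prodV g : is_conj_prod g -> is_conj_prod g^-1.
Proof.
case=> l ->; exists [seq (~~ k.1, k.2) | k <- rev l].
rewrite /conj_prod big_map -[in LHS](revK l) -prodgV.
apply: eq_bigr => -[b u] _ /=.
by rewrite -conjVg; case: b; rewrite ?invgK.
Qed.

Lemma is_conj_prodJ g h : is_conj_prod g -> is_conj_prod (g ^ h).
Proof.
case=> l ->; exists [seq (k.1, k.2 * h) | k <- l].
rewrite /conj_prod conjg_prod big_map.
by apply: eq_bigr => k _ /=; rewrite conjgM.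
Qed.

Lemma is_conj_prodR g h : is_conj_prod [~ g, h] -> is_conj_prod [~ h, g].
Proof. by rewrite -[[~ h, g]]invgR; apply: is_conj_prodV. Qed.

End ConjugateProducts.

Lemma gmorph_conj_prod (G H : groupType) (f : {multiplicative G -> H}) c l :
  f (conj_prod c l) = conj_prod (f c) [seq (k.1, f k.2) | k <- l].
Proof.
rewrite /conj_prod gmorph_prod big_map; apply: eq_bigr => -[b u] _ /=.
by rewrite gmorphJ; case: b; rewrite ?gmorphV.
Qed.

Section FreeGroupWords.
Local Open Scope group_scope.

(** A reduced word is the product of its letters: prepending the first letter
to the rest cancels nothing. *)
Lemma free_group_ind (I : choiceType) (P : free_group I -> Prop) :
  P 1 -> (forall u v, P u -> P v -> P (u * v)) ->
  (forall i, P (free_gen i)) -> (forall i, P (free_gen i)^-1) -> forall w, P w.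
Proof.
move=> P1 PM Pg PV [w]; elim: w => [|[i b] w IHw] rw.
  by rewrite (_ : FreeGroup rw = 1) //; apply: val_inj.
have -> : FreeGroup rw = (if b then free_gen i else (free_gen i)^-1)
                         * FreeGroup (path_sorted rw).
  apply: val_inj; case: b rw => rw /=; case: w {IHw} rw => [|a w] //=.
    by case/andP=> /negPf ->.
  by case/andP=> /negPf ->.
by apply: PM; [case: b {rw} | apply: IHw].
Qed.

Definition gen_a : F2 := free_gen ord0.
Definition gen_b : F2 := free_gen ord_max.
Definition comm_ab : F2 := [~ gen_a, gen_b].

Lemma F2_ind (P : F2 -> Prop) :
  P 1 -> (forall u v, P u -> P v -> P (u * v)) ->
  P gen_a -> P gen_a^-1 -> P gen_b -> P gen_b^-1 -> forall w, P w.
Proof.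
move=> P1 PM Pa PaV Pb PbV; apply: free_group_ind => // i.
  by have [->|->] : i = ord0 \/ i = ord_max by
    case: i => -[|[|//]] ?; [left | right]; apply: val_inj.
by have [->|->] : i = ord0 \/ i = ord_max by
    case: i => -[|[|//]] ?; [left | right]; apply: val_inj.
Qed.

Lemma commgMr_conj (G : groupType) (g u v : G) :
  [~ g, u * v] = [~ g, v] * [~ g, u] ^ v.
Proof.
rewrite !commgEl conjgM [(_ * _) ^ v in RHS]conjMg conjVg -[RHS]mulgA.
by congr (_ * _); apply/esym/mulVKg.
Qed.

(** The normal closure of the commutator of the generators contains every
commutator: for fixed g, the set of w with [~ g, w] in it is a subgroup, so it
is enough to test generators on both sides. *)
Lemma F2_commg_conj_prod (u v : F2) : is_conj_prod comm_ab [~ u, v].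
Proof.
pose N := is_conj_prod comm_ab.
have N1 : N 1 by exists [::]; rewrite /conj_prod big_nil.
have Nc : N comm_ab.
  by exists [:: (false, 1)]; rewrite /conj_prod big_seq1 conjg1.
have ext g : N [~ g, gen_a] -> N [~ g, gen_b] -> forall w, N [~ g, w].
  have V x : N [~ g, x] -> N [~ g, x^-1].
    move=> Nx; have : N ([~ g, x]^-1 ^ x^-1).
      exact/is_conj_prodJ/is_conj_prodV.
    congr N; apply: (mulIg ([~ g, x] ^ x^-1)).
    by rewrite -commgMr_conj mulgV commg1 -conjMg mulVg conj1g.
  move=> Na Nb; apply: F2_ind.
  - by rewrite commg1.
  - move=> w w' Nw Nw'; rewrite commgMr_conj.
    exact/is_conj_prodM/is_conj_prodJ.
  - exact: Na.
  - exact: V.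
  - exact: Nb.
  - exact: V.
by apply: (ext); apply: is_conj_prodR; apply: (ext); rewrite ?commgg //;
  apply: is_conj_prodR.
Qed.

End FreeGroupWords.

Section Exponents.
Local Open Scope ring_scope.

(** The exponent sums, that is, the coordinates of the abelianization. *)
Definition expo (i : 'I_2) (w : F2) : int :=
  \sum_(a <- word w | a.1 == i) (-1) ^+ ~~ a.2.

Lemma expoM i (u v : F2) : expo i (u * v)%g = expo i u + expo i v.
Proof.
rewrite /expo /=; elim: (word u) => [|a w IHw] /=; first by rewrite big_nil add0r.
rewrite [in RHS]big_cons; set s := \sum_(j <- w | _) _ in IHw *.
transitivity ((if a.1 == i then (-1) ^+ ~~ a.2 else 0 : int) +
    \sum_(j <- word_mul w (word v) | j.1 == i) (-1) ^+ ~~ j.2).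
  case: (word_mul w _) => [|b t] /=.
    by rewrite big_cons big_nil; case: ifP; rewrite ?addr0.
  case: eqP => [->|_]; rewrite !big_cons //=.
    case: ifP => _; rewrite ?add0r //.
    by case: a.2; rewrite addrA ?subrr ?addNr add0r.
  by case: (a.1 == i); rewrite ?add0r.
by rewrite IHw; case: ifP; rewrite ?add0r ?addrA.
Qed.

Lemma expo1 i : expo i 1%g = 0.
Proof. by rewrite /expo big_nil. Qed.

Lemma expoV i (u : F2) : expo i u^-1%g = - expo i u.
Proof. by apply/eqP; rewrite -addr_eq0 -expoM mulVg expo1. Qed.

Lemma expo_gen : ((expo ord0 gen_a = 1) * (expo ord_max gen_a = 0)) *
  ((expo ord0 gen_b = 0) * (expo ord_max gen_b = 1)).
Proof. by do !split; rewrite /expo /= big_cons big_nil. Qed.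

End Exponents.

(** * Affine representations *)

Section AffineGroup.
Local Open Scope ring_scope.
Variable L : fieldType.

(** The pair (m, f) stands for the affine map z |-> m z + f. *)
Definition affine := {p : L * L | p.1 != 0}.
HB.instance Definition _ := Choice.on affine.

Definition lin (g : affine) : L := (val g).1.
Definition trans (g : affine) : L := (val g).2.

Lemma lin_neq0 g : lin g != 0.
Proof. exact: valP g. Qed.

Definition mk_affine m (m0 : m != 0) (z : L) : affine := exist _ (m, z) m0.

Lemma affine_eq g h : lin g = lin h -> trans g = trans h -> g = h.
Proof.
move=> gh1 gh2; apply: val_inj; apply/eqP/andP.
by rewrite -/(lin g) gh1 -/(trans g) gh2.
Qed.

Definition affine_one := mk_affine (oner_neq0 L) 0.
Definition affine_mul g h := @mk_affine ((val g).1 * (val h).1)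
  (mulf_neq0 (lin_neq0 g) (lin_neq0 h)) ((val g).2 + (val g).1 * (val h).2).
Definition affine_inv g := @mk_affine (val g).1^-1
  (invr_neq0 (lin_neq0 g)) (- (val g).1^-1 * (val g).2).

Lemma affine_mulA : associative affine_mul.
Proof. by move=> f g h; apply: affine_eq; rewrite /lin /trans /=; ring. Qed.
Lemma affine_mul1 : left_id affine_one affine_mul.
Proof. by move=> g; apply: affine_eq; rewrite /lin /trans /=; ring. Qed.
Lemma affine_1mul : right_id affine_one affine_mul.
Proof. by move=> g; apply: affine_eq; rewrite /lin /trans /=; ring. Qed.
Lemma affine_mulV : left_inverse affine_one affine_inv affine_mul.
Proof.
move=> g; have := lin_neq0 g => g0.
by apply: affine_eq; rewrite /lin /trans /=; field.
Qed.
Lemma affine_Vmul : right_inverse affine_one affine_inv affine_mul.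
Proof.
move=> g; have := lin_neq0 g => g0.
by apply: affine_eq; rewrite /lin /trans /=; field.
Qed.

HB.instance Definition _ := isGroup.Build affine
  affine_mulA affine_mul1 affine_1mul affine_mulV affine_Vmul.

Lemma linM g h : lin (g * h)%g = lin g * lin h. Proof. by []. Qed.
Lemma transM g h : trans (g * h)%g = trans g + lin g * trans h. Proof. by []. Qed.
Lemma linV g : lin g^-1%g = (lin g)^-1. Proof. by []. Qed.
Lemma transV g : trans g^-1%g = - (lin g)^-1 * trans g. Proof. by []. Qed.

Lemma lin_commg g h : lin [~ g, h]%g = 1.
Proof.
have g0 := lin_neq0 g; have h0 := lin_neq0 h.
by rewrite !linM !linV; field; rewrite ?g0 ?h0.
Qed.

Lemma trans_commg g h : trans [~ g, h]%g =
  (lin g * lin h)^-1 * ((lin g - 1) * trans h - (lin h - 1) * trans g).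
Proof.
have g0 := lin_neq0 g; have h0 := lin_neq0 h.
by rewrite !(linM, transM) !(linV, transV); field; rewrite ?g0 ?h0.
Qed.

Lemma linJ g h : lin (g ^ h)%g = lin g.
Proof.
by have h0 := lin_neq0 h; rewrite !linM linV; field; rewrite ?h0.
Qed.

Lemma transJ g h : lin g = 1 -> trans (g ^ h)%g = (lin h)^-1 * trans g.
Proof.
have h0 := lin_neq0 h => g1.
by rewrite /conjg transM linV transV transM g1; field; rewrite ?h0.
Qed.

(** Translations form an abelian normal subgroup, on which conjugation by g is
multiplication by the inverse of the linear part of g. *)
Lemma affine_conj_prod (c : affine) l : lin c = 1 ->
  lin (conj_prod c l) = 1 /\ trans (conj_prod c l) =
    (\sum_(k <- l) (-1) ^+ (k.1 : bool) * (lin k.2)^-1) * trans c.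
Proof.
rewrite /conj_prod => c1; elim: l => [|[b u] l [IH1 IH2]].
  by rewrite !big_nil mul0r.
have cb1 : lin (if b then c^-1 else c)%g = 1 by case: b; rewrite ?linV c1 ?invr1.
have cbE : trans (if b then c^-1 else c)%g = (-1) ^+ b * trans c.
  by case: b {cb1}; rewrite ?transV ?c1 ?expr1 ?invr1 ?expr0 ?mul1r.
rewrite !big_cons linM transM IH1 IH2 linJ transJ // cb1 cbE /=.
by split; [rewrite mulr1 | ring].
Qed.

End AffineGroup.

Section AutomorphismMoments.
Local Open Scope ring_scope.
Variable K : fieldType.
Notation L := {fraction {poly K}}.

Lemma lin_morph (rho : {multiplicative F2 -> affine L}) (w : F2) :
  lin (rho w) = lin (rho gen_a) ^ expo ord0 w * lin (rho gen_b) ^ expo ord_max w.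
Proof.
have a0 := lin_neq0 (rho gen_a); have b0 := lin_neq0 (rho gen_b).
elim/F2_ind: w => [|u v IHu IHv||||].
- by rewrite gmorph1 !expo1 !expr0z mulr1.
- rewrite gmulfM linM IHu IHv !expoM.
  by rewrite (expfzDr _ _ a0) (expfzDr _ _ b0) mulrACA.
- by rewrite !expo_gen expr1z expr0z mulr1.
- by rewrite gmorphV linV !expoV !expo_gen oppr0 exprN1 expr0z mulr1.
- by rewrite !expo_gen expr1z expr0z mul1r.
- by rewrite gmorphV linV !expoV !expo_gen oppr0 exprN1 expr0z mul1r.
Qed.

Lemma Tvar_neq1 : Tvar K - 1 != 0.
Proof.
rewrite subr_eq0 /Tvar -tofrac1 tofrac_eq.
apply/eqP => /(congr1 (fun p : {poly K} => size p)).
by rewrite size_polyX size_poly1.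
Qed.

Definition sgn (k : bool * F2) : K := (-1) ^+ k.1.

(** Let rho send a and b to the affine maps z |-> T^p z + f and z |-> T^q z + f'.
The inequality says that rho c is a translation by some nonzero delta.  If delta'
is the translation part of rho (sigma c), expressing sigma c through conjugates
of c makes delta' a multiple of delta, and expressing tau c through conjugates of
c makes delta a multiple of delta'; both multipliers are Laurent polynomials, so
they are units. *)
Lemma automorphism_variance (sigma tau : {multiplicative F2 -> F2})
    (p q : int) f f' l :
  cancel tau sigma ->
  (Tvar K ^ p - 1) * f' != (Tvar K ^ q - 1) * f ->
  sigma comm_ab = conj_prod comm_ab l ->
  let n k := - (p * expo ord0 k.2 + q * expo ord_max k.2) in
  moment l sgn (fun=> 1) * moment l sgn (fun k => n k * n k) =
  moment l sgn n ^+ 2.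
Proof.
move=> tauK nz sE n; set T := Tvar K in nz *.
have T0 m : T ^ m != 0 by rewrite expfz_neq0 // Tvar_neq0.
pose A (i : 'I_2) :=
  if i == ord0 then mk_affine (T0 p) f else mk_affine (T0 q) f'.
pose rho : {multiplicative F2 -> affine L} := free_lift A.
have ra : rho gen_a = mk_affine (T0 p) f by rewrite /rho /= free_lift_gen.
have rb : rho gen_b = mk_affine (T0 q) f' by rewrite /rho /= free_lift_gen.
have lin_rho w : lin (rho w) = T ^ (p * expo ord0 w + q * expo ord_max w).
  by rewrite lin_morph ra rb /lin /= !exprz_exp expfzDr ?Tvar_neq0.
have c0 : trans (rho comm_ab) != 0.
  rewrite gmorphR trans_commg ra rb /lin /trans /= mulf_neq0 ?subr_eq0 //.
  by rewrite invr_neq0 // mulf_neq0.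
have c1 : lin (rho comm_ab) = 1 by rewrite gmorphR lin_commg.
have d1 : lin (rho (sigma comm_ab)) = 1 by rewrite !gmorphR lin_commg.
have lE (h : F2 -> F2) (s : seq (bool * F2)) (c : affine L) : lin c = 1 ->
    trans (conj_prod c [seq (k.1, rho (h k.2)) | k <- s]) =
    laurent s sgn (fun k => - (p * expo ord0 (h k.2) + q * expo ord_max (h k.2)))
    * trans c.
  move=> c'1; rewrite (affine_conj_prod _ c'1).2 big_map; congr (_ * _).
  apply: eq_bigr => k _ /=.
  by rewrite lin_rho invr_expz rmorphXn rmorphN1 tofracXn tofracN tofrac1.
have [l' tE] := F2_commg_conj_prod (tau gen_a) (tau gen_b).
pose n' (k : bool * F2) :=
  - (p * expo ord0 (sigma k.2) + q * expo ord_max (sigma k.2)).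
have dE : trans (rho (sigma comm_ab)) = laurent l sgn n * trans (rho comm_ab).
  by rewrite -(lE id _ _ c1) sE gmorph_conj_prod.
have cE : trans (rho comm_ab) = laurent l' sgn n' * trans (rho (sigma comm_ab)).
  rewrite -(lE sigma _ _ d1) -[in LHS](tauK comm_ab) [tau _]gmorphR tE.
  by rewrite !gmorph_conj_prod -map_comp.
apply: (laurent_unit_variance (s := l') (d := sgn) (m := n')).
by apply: (mulIf c0); rewrite mul1r mulrAC -dE mulrC -cE.
Qed.

(** The variance vanishes along the directions (1, 0), (0, 1) and (1, 1);
polarization gives the covariance. *)
Lemma automorphism_moments (sigma tau : {multiplicative F2 -> F2}) l :
  (2 != 0 :> K) -> cancel tau sigma -> sigma comm_ab = conj_prod comm_ab l ->
  let i k := expo ord0 k.2 in let j k := expo ord_max k.2 in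
  moment l sgn (fun=> 1) * moment l sgn (fun k => i k * j k) =
  moment l sgn i * moment l sgn j.
Proof.
move=> two tauK sE i j; set m0 := moment l sgn (fun=> 1).
set mi := moment l sgn i; set mj := moment l sgn j; set mij := moment l sgn _.
pose mii := moment l sgn (fun k => i k * i k).
pose mjj := moment l sgn (fun k => j k * j k).
have quad (p q : int) z z' : (Tvar K ^ p - 1) * z' != (Tvar K ^ q - 1) * z ->
    m0 * (p%:~R ^+ 2 * mii + (p * q)%:~R * mij *+ 2 + q%:~R ^+ 2 * mjj) =
    (p%:~R * mi + q%:~R * mj) ^+ 2.
  move=> nz; rewrite -[RHS]sqrrN.
  have := automorphism_variance tauK nz sE => /= E.
  transitivity (moment l sgn (fun k => - (p * i k + q * j k)) ^+ 2).
    rewrite -E; congr (_ * _).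
    rewrite /mii /mij /mjj /moment -mulrnAr !mulr_sumr -sumrMnl !mulr_sumr.
    rewrite -!big_split.
    by apply: eq_bigr => k _ /=; rewrite !(intrM, rmorphN, intrD); ring.
  congr (_ ^+ 2); rewrite /mi /mj /moment !mulr_sumr -big_split -sumrN.
  by apply: eq_bigr => k _ /=; rewrite !(intrM, rmorphN, intrD); ring.
have T1 := Tvar_neq1.
have Eii : m0 * mii = mi ^+ 2.
  have := @quad 1 0 0 1; rewrite expr1z mulr1 mulr0 => /(_ T1).
  by rewrite mulr1z mulr0z !(mul0r, mul1r, expr1n, expr0n, mul0rn, addr0).
have Ejj : m0 * mjj = mj ^+ 2.
  have := @quad 0 1 1 0; rewrite expr1z mulr1 mulr0 eq_sym => /(_ T1).
  by rewrite mulr1z mulr0z !(mul0r, mul1r, expr1n, expr0n, mul0rn, add0r).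
have Eij : m0 * (mii + mij *+ 2 + mjj) = (mi + mj) ^+ 2.
  have := @quad 1 1 0 1; rewrite expr1z mulr1 mulr0 => /(_ T1).
  by rewrite mulr1z !(mul1r, expr1n).
apply: (mulfI two); apply: (addIr (mi ^+ 2 + mj ^+ 2)).
transitivity ((mi + mj) ^+ 2); last by ring.
by rewrite -Eii -Ejj -Eij; ring.
Qed.

End AutomorphismMoments.

(** * Level-three portraits *)

Section Portraits.
Local Open Scope ring_scope.

Lemma F3_ind (P : 'F_3 -> Prop) : P 0 -> P 1 -> P 2 -> forall i, P i.
Proof.
move=> P0 P1 P2 [[|[|[|//]]] lt_i].
- by rewrite (_ : Ordinal lt_i = 0) //; apply: val_inj.
- by rewrite (_ : Ordinal lt_i = 1) //; apply: val_inj.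
- by rewrite (_ : Ordinal lt_i = 2) //; apply: val_inj.
Qed.

(** Identities in characteristic three are obtained from identities over the
integers in which a multiple of 3 is made explicit. *)
Lemma eq_mod3 (e x y : 'F_3) : x = y + 3 * e -> x = y.
Proof. by rewrite (_ : 3 = 0) ?mul0r ?addr0 //; apply: val_inj. Qed.

Definition v3 (i j k : 'F_3) : vertex := [:: i; j; k].

(** On words of length three, elements of G_3 rotate each letter by an amount
depending on the previous ones, and the rotation of the third letter is an affine
function of the second: the generators have this property and it is preserved by
products.  The variable j + 1 rather than j makes the offset ga vanish for the
generator y. *)
Definition portrait (g : tree_aut) (r : 'F_3) (al be ga : 'F_3 -> 'F_3) :=
  forall i j k,
    g (v3 i j k) = v3 (i + r) (j + al i) (k + (ga i + be i * (j + 1))).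

Lemma v3_inj i j k i' j' k' : v3 i j k = v3 i' j' k' -> j = j' /\ k = k'.
Proof. by case. Qed.

Lemma tree_mulE (g h : tree_aut) (v : vertex) : (g * h)%g v = g (h v).
Proof. by []. Qed.

Lemma tree_invP (g : tree_aut) (u v : vertex) : g u = v -> g^-1%g v = u.
Proof. by move=> <-; apply: tree_funK. Qed.

Lemma tree_conjP (g h : tree_aut) (u v : vertex) :
  g (h v) = h u -> (g ^ h)%g v = u.
Proof. by move=> gh; apply: tree_invP; rewrite /= gh. Qed.

(** The section of g below the letter i acts on two letters through the Heisenberg
group over F_3, with coordinates (al i, be i, ga i); for g in the derived
subgroup, al is constant and be is affine with slope al.  The offsets ga multiply
with a cocycle be * al.  It cancels in their sum n2, and in their first moment it
leaves a multiple of the product of the values of n0, which the square of n0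
corrects.  The order of the coordinates is that of the basis
1, X - 1, Y - 1, (X - 1)(Y - 1). *)
Definition derived_coords (g : tree_aut) (n0 n1 n2 n3 : 'F_3) :=
  exists2 ga, portrait g 0 (fun=> n0) (fun i => n1 + n0 * i) ga &
    n2 = ga 0 + ga 1 + ga 2 /\ n3 = n0 ^+ 2 - (ga 1 + 2 * ga 2).

Lemma derived_coords1 : derived_coords 1%g 0 0 0 0.
Proof.
exists (fun=> 0); last by split; ring.
by move=> i j k; transitivity (v3 i j k) => //; congr v3; ring.
Qed.

Lemma derived_coordsM g h n0 n1 n2 n3 m0 m1 m2 m3 :
  derived_coords g n0 n1 n2 n3 -> derived_coords h m0 m1 m2 m3 ->
  derived_coords (g * h)%g (n0 + m0) (n1 + m1) (n2 + m2) (n3 + m3).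
Proof.
case=> ga gP [-> ->] [ga' hP [-> ->]].
exists (fun i => ga i + ga' i + (n1 + n0 * i) * m0).
  move=> i j k /=; rewrite hP gP !addr0.
  congr v3; ring.
by split; [apply: (@eq_mod3 (- (n1 + n0) * m0))
         | apply: (@eq_mod3 ((n1 + n0) * m0))]; ring.
Qed.

Lemma derived_coordsV g n0 n1 n2 n3 :
  derived_coords g n0 n1 n2 n3 ->
  derived_coords g^-1%g (- n0) (- n1) (- n2) (- n3).
Proof.
case=> ga gP [-> ->]; exists (fun i => - ga i + (n1 + n0 * i) * n0).
  by move=> i j k; apply: tree_invP; rewrite gP !addr0; congr v3; ring.
by split; [apply: (@eq_mod3 (- (n1 + n0) * n0))
         | apply: (@eq_mod3 ((n1 + n0) * n0))]; ring.
Qed.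

(** Covers conjugation by x (r = 1) and by its inverse (r = -1), which permute
the three sections. *)
Lemma derived_coordsJ_rot g h r n0 n1 n2 n3 :
  portrait h r (fun=> 0) (fun=> 0) (fun=> 0) ->
  derived_coords g n0 n1 n2 n3 ->
  derived_coords (g ^ h)%g n0 (n1 + r * n0) n2 (n3 + r * n2).
Proof.
move=> hP [ga gP [-> ->]]; exists (fun i => ga (i + r)).
  by move=> i j k; apply: tree_conjP; rewrite !hP gP !addr0; congr v3; ring.
elim/F3_ind: r {hP}; rewrite ?add0r ?addr0.
- split; ring.
- have -> : 1 + 1 = 2 :> 'F_3 by apply/eqP.
  have -> : 2 + 1 = 0 :> 'F_3 by apply/eqP.
  by split; [ring | apply: (@eq_mod3 (ga 0)); ring].
- have -> : 1 + 2 = 0 :> 'F_3 by apply/eqP.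
  have -> : 2 + 2 = 1 :> 'F_3 by apply/eqP.
  by split; [ring | apply: (@eq_mod3 (ga 0 + ga 1)); ring].
Qed.

(** Covers conjugation by y (s = 1) and by its inverse (s = -1), which acts on
each section by an inner automorphism of the Heisenberg group. *)
Lemma derived_coordsJ_diag g h s al be ga n0 n1 n2 n3 :
  portrait h 0 al be ga -> (forall i, al i = s * (1 + i)) ->
  be 0 = 0 -> be 1 = 0 -> be 2 = s -> derived_coords g n0 n1 n2 n3 ->
  derived_coords (g ^ h)%g n0 n1 (n2 + s * n0) (n3 + s * n1).
Proof.
move=> hP alE be0 be1 be2 [ga' gP [-> ->]].
exists (fun i => ga' i + (n1 + n0 * i) * al i - be i * n0).
  by move=> i j k; apply: tree_conjP; rewrite !hP gP !addr0; congr v3; ring.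
rewrite !alE be0 be1 be2.
by split; [apply: (@eq_mod3 (- 2 * s * (n1 + n0)))
         | apply: (@eq_mod3 (s * (3 * n1 + 4 * n0)))]; ring.
Qed.

Lemma derived_coords_uniq (g h : tree_aut) n0 n1 n2 n3 m0 m1 m2 m3 :
  (forall v : vertex, size v = 3 -> g v = h v) ->
  derived_coords g n0 n1 n2 n3 -> derived_coords h m0 m1 m2 m3 ->
  [/\ n0 = m0, n1 = m1, n2 = m2 & n3 = m3].
Proof.
move=> gh [ga gP [-> ->]] [ga' hP [-> ->]].
have E i j k := gh (v3 i j k) erefl.
have n0m0 : n0 = m0.
  by have := E 0 0 0; rewrite gP hP => /v3_inj[/addrI].
have gaE i : ga i = ga' i.
  have := E i (-1) 0; rewrite gP hP => /v3_inj[_].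
  by rewrite addNr !mulr0 !addr0 !add0r.
have n1m1 : n1 = m1.
  have := E 0 0 0; rewrite gP hP => /v3_inj[_].
  by rewrite !mulr0 !addr0 !add0r !mulr1 gaE => /addrI.
by rewrite !gaE n0m0 n1m1.
Qed.

End Portraits.

(** * The generators on the third level *)

Section Generators.
Local Open Scope ring_scope.

Lemma gs_piE (s : 'F_3) : gs_pi s = s + 1.
Proof. by apply: val_inj; case: s => -[|[|[|]]]. Qed.

Lemma gs_x_cons (s : 'F_3) sigma : gs_x (s :: sigma) = (s + 1 : 'F_3) :: sigma.
Proof. by rewrite -gs_piE. Qed.

Lemma gs_xV_cons (s : 'F_3) sigma :
  gs_x^-1%g (s :: sigma) = (s - 1 : 'F_3) :: sigma.
Proof. by apply: tree_invP; rewrite gs_x_cons subrK. Qed.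

Definition y_al (i : 'F_3) : 'F_3 := 1 + i.
Definition y_be (i : 'F_3) : 'F_3 := (i == 2)%:R.

Lemma portrait_x : portrait gs_x 1 (fun=> 0) (fun=> 0) (fun=> 0).
Proof. by move=> i j k; rewrite /v3 gs_x_cons; congr v3; ring. Qed.

Lemma portrait_xV : portrait gs_x^-1%g (- 1) (fun=> 0) (fun=> 0) (fun=> 0).
Proof. by move=> i j k; rewrite /v3 gs_xV_cons; congr v3; ring. Qed.

Lemma gs_y0 sigma : gs_y ((0 : 'F_3) :: sigma) = (0 : 'F_3) :: gs_x sigma.
Proof. by []. Qed.
Lemma gs_y1 sigma : gs_y ((1 : 'F_3) :: sigma) = (1 : 'F_3) :: gs_x^-1%g sigma.
Proof. by []. Qed.
Lemma gs_y2 sigma : gs_y ((2 : 'F_3) :: sigma) = (2 : 'F_3) :: gs_y sigma.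
Proof. by []. Qed.

Lemma y_alE : (y_al 0 = 1) * (y_al 1 = - 1) * (y_al 2 = 0).
Proof. by do !split; apply/eqP. Qed.

Lemma y_beE : (y_be 0 = 0) * (y_be 1 = 0) * (y_be 2 = 1).
Proof. by []. Qed.

Lemma portrait_y : portrait gs_y 0 y_al y_be (fun=> 0).
Proof.
move=> + j k; apply: F3_ind; rewrite /v3 ?y_alE ?y_beE.
- by rewrite gs_y0 gs_x_cons; congr v3; ring.
- by rewrite gs_y1 gs_xV_cons; congr v3; ring.
rewrite gs_y2; congr (_ :: _); first by rewrite addr0.
have -> : 0 + 1 * (j + 1) = y_al j by rewrite /y_al; ring.
(* On two letters the section y of y below 2 acts as y itself does. *)
elim/F3_ind: j; rewrite !(gs_y0, gs_y1, gs_y2) ?gs_x_cons ?gs_xV_cons y_alE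
  ?addr0 //.
by elim/F3_ind: k; rewrite !(gs_y0, gs_y1, gs_y2) // (tree_invP (u := [::])).
Qed.

Lemma portrait_yV :
  portrait gs_y^-1%g 0 (fun i => - y_al i) (fun i => - y_be i)
    (fun i => y_be i * y_al i).
Proof.
move=> i j k; apply: tree_invP; rewrite portrait_y !addr0.
by congr v3; ring.
Qed.

Lemma derived_coordsJ_x g n0 n1 n2 n3 : derived_coords g n0 n1 n2 n3 ->
  derived_coords (g ^ gs_x)%g n0 (n1 + n0) n2 (n3 + n2).
Proof. by move=> /(derived_coordsJ_rot portrait_x); rewrite !mul1r. Qed.

Lemma derived_coordsJ_xV g n0 n1 n2 n3 : derived_coords g n0 n1 n2 n3 ->
  derived_coords (g ^ gs_x^-1)%g n0 (n1 - n0) n2 (n3 - n2).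
Proof. by move=> /(derived_coordsJ_rot portrait_xV); rewrite !mulN1r. Qed.

Lemma derived_coordsJ_y g n0 n1 n2 n3 : derived_coords g n0 n1 n2 n3 ->
  derived_coords (g ^ gs_y)%g n0 n1 (n2 + n0) (n3 + n1).
Proof.
have alE i : y_al i = 1 * (1 + i) by rewrite mul1r.
have [[b0 b1] b2] := y_beE.
by move=> /(derived_coordsJ_diag portrait_y alE b0 b1 b2); rewrite !mul1r.
Qed.

Lemma derived_coordsJ_yV g n0 n1 n2 n3 : derived_coords g n0 n1 n2 n3 ->
  derived_coords (g ^ gs_y^-1)%g n0 n1 (n2 - n0) (n3 - n1).
Proof.
have alE i : - y_al i = -1 * (1 + i) by rewrite mulN1r.
have b0 : - y_be 0 = 0 by rewrite y_beE oppr0.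
have b1 : - y_be 1 = 0 by rewrite y_beE oppr0.
have b2 : - y_be 2 = -1 by rewrite y_beE.
by move=> /(derived_coordsJ_diag portrait_yV alE b0 b1 b2); rewrite !mulN1r.
Qed.

Definition c_ga (i : 'F_3) : 'F_3 := y_be (i + 1).

Lemma portrait_comm :
  portrait [~ gs_x, gs_y]%g 0 (fun=> -1) (fun i => 0 + -1 * i) c_ga.
Proof.
have -> : [~ gs_x, gs_y]%g = ((gs_y * gs_x)^-1 * (gs_x * gs_y))%g.
  by rewrite (commgC gs_x gs_y) [RHS]mulKg.
move=> i j k; apply: (@tree_invP (gs_y * gs_x)%g _ ((gs_x * gs_y)%g _)).
rewrite !tree_mulE !(portrait_x, portrait_y) /c_ga !addr0 !mul0r !addr0 !add0r.
congr v3; first by rewrite /y_al; ring.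
have -> : y_be i = y_be (i + 1) - i by elim/F3_ind: i; apply/eqP.
by ring.
Qed.

Lemma derived_coords_comm : derived_coords [~ gs_x, gs_y]%g (-1) 0 1 0.
Proof. by exists c_ga; [apply: portrait_comm | split; apply/eqP]. Qed.

(** The monomial X^i Y^j is 1 + i (X - 1) + j (Y - 1) + i j (X - 1) (Y - 1) modulo
the squares of X - 1 and Y - 1. *)
Lemma derived_coordsJ_word (f : {multiplicative F2 -> tree_aut}) (w : F2)
    g n0 n1 n2 n3 :
  f gen_a = gs_x -> f gen_b = gs_y -> derived_coords g n0 n1 n2 n3 ->
  let i := (expo ord0 w)%:~R in let j := (expo ord_max w)%:~R in
  derived_coords (g ^ f w)%g n0 (n1 + i * n0) (n2 + j * n0)
    (n3 + i * n2 + j * n1 + i * j * n0).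
Proof.
move=> fa fb.
elim/F2_ind: w g n0 n1 n2 n3 => [|u v IHu IHv||||] g n0 n1 n2 n3 gN /=.
- by rewrite gmorph1 conjg1 !expo1 !mul0r !addr0.
- rewrite gmulfM conjgM !expoM !intrD.
  have := IHv _ _ _ _ _ (IHu _ _ _ _ _ gN); congr derived_coords; ring.
- have := derived_coordsJ_x gN; rewrite fa !expo_gen mulr1z mulr0z.
  by rewrite !(mul0r, mul1r, addr0).
- have := derived_coordsJ_xV gN.
  rewrite gmorphV fa !expoV !expo_gen oppr0 mulrN1z mulr0z.
  by rewrite !(mul0r, mulr0, mulN1r, oppr0, addr0).
- have := derived_coordsJ_y gN; rewrite fb !expo_gen mulr1z mulr0z.
  by rewrite !(mul0r, mul1r, addr0).
- have := derived_coordsJ_yV gN.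
  rewrite gmorphV fb !expoV !expo_gen oppr0 mulrN1z mulr0z.
  by rewrite !(mul0r, mulr0, mulN1r, oppr0, addr0).
Qed.


(** Since [~ x, y] has coordinates (-1, 0, 1, 0), which is - Y^-1, its conjugate by
a word with exponents i and j has coordinates - (1, i, j - 1, i (j - 1)); the
coordinates of a product of such conjugates are moments of their exponents. *)
Lemma derived_coords_conj_prod (f : {multiplicative F2 -> tree_aut}) l :
  f gen_a = gs_x -> f gen_b = gs_y ->
  let i k := expo ord0 k.2 in let j k := expo ord_max k.2 in
  let m := moment l (sgn 'F_3) in
  derived_coords (f (conj_prod comm_ab l)) (- m (fun=> 1)) (- m i)
    (m (fun=> 1) - m j) (m i - m (fun k => i k * j k)).
Proof.
move=> fa fb i j m; rewrite {}/m; elim: l => [|[b u] l IHl].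
  rewrite /conj_prod /moment !big_nil gmorph1 subrr oppr0; exact: derived_coords1.
rewrite [conj_prod _ _]big_cons gmulfM; set s := sgn 'F_3 (b, u).
suff uP : derived_coords (f ((if b then comm_ab^-1 else comm_ab) ^ u)%g)
    (- s) (- (s * (i (b, u))%:~R)) (s - s * (j (b, u))%:~R)
    (s * (i (b, u))%:~R - s * (i (b, u) * j (b, u))%:~R).
  have := derived_coordsM uP IHl; rewrite /moment !big_cons -/s mulr1.
  by congr derived_coords; ring.
have := derived_coordsJ_word u fa fb derived_coords_comm.
rewrite -[gs_x in [~ gs_x, _]%g]fa -[gs_y in [~ _, gs_y]%g]fb.
rewrite -gmorphR -gmorphJ -/comm_ab /s /sgn /i /j /= {s}; case: b => /= uP.
  have := derived_coordsV uP; rewrite -gmorphV -conjVg expr1.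
  by congr derived_coords; rewrite ?intrM; ring.
by move: uP; rewrite expr0; congr derived_coords; rewrite ?intrM; ring.
Qed.

End Generators.

(** * An automorphism of the Gupta-Sidki group *)

Section TwistedPair.
Local Open Scope group_scope.

Definition gs_t_fun (v : vertex) : vertex :=
  if v is s :: sigma then s :: gs_x sigma else [::].
Definition gs_tV_fun (v : vertex) : vertex :=
  if v is s :: sigma then s :: gs_x^-1 sigma else [::].

Lemma gs_t_subproof : is_tree_aut gs_t_fun.
Proof.
apply: (@is_tree_aut_intro _ gs_tV_fun) => //.
- by case=> // s v; congr (_ :: _); apply: tree_funK.
- by case=> // s v; congr (_ :: _); apply: (tree_inv_funK gs_x).
case=> [|s u] r; first by exists r.
by have [r' E] := gs_x_rcons u r; exists r'; rewrite /= E.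
Qed.

Definition gs_t : tree_aut := TreeAut (asboolT gs_t_subproof).

Definition diag (g f0 f1 f2 : tree_aut) := forall sigma : vertex,
  [/\ g ((0%R : 'F_3) :: sigma) = (0%R : 'F_3) :: f0 sigma,
      g ((1%R : 'F_3) :: sigma) = (1%R : 'F_3) :: f1 sigma &
      g ((2%R : 'F_3) :: sigma) = (2%R : 'F_3) :: f2 sigma].

Lemma diag_eq g h f0 f1 f2 : diag g f0 f1 f2 -> diag h f0 f1 f2 -> g = h.
Proof.
move=> gD hD; apply: tree_aut_eq => -[|s sigma].
  by have [_ -> _] := tree_autP g; have [_ -> _] := tree_autP h.
have [g0 g1 g2] := gD sigma; have [h0 h1 h2] := hD sigma.
by elim/F3_ind: s; rewrite ?g0 ?g1 ?g2 ?h0 ?h1 ?h2.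
Qed.

Lemma diagM g h f0 f1 f2 k0 k1 k2 : diag g f0 f1 f2 -> diag h k0 k1 k2 ->
  diag (g * h) (f0 * k0) (f1 * k1) (f2 * k2).
Proof.
move=> gD hD sigma; have [h0 h1 h2] := hD sigma; rewrite !tree_mulE h0 h1 h2.
by have [-> _ _] := gD (k0 sigma); have [_ -> _] := gD (k1 sigma);
  have [_ _ ->] := gD (k2 sigma).
Qed.

Lemma diagV g f0 f1 f2 : diag g f0 f1 f2 -> diag g^-1 f0^-1 f1^-1 f2^-1.
Proof.
move=> gD sigma; split; apply: tree_invP.
- by have [-> _ _] := gD (f0^-1 sigma); rewrite -tree_mulE mulgV.
- by have [_ -> _] := gD (f1^-1 sigma); rewrite -tree_mulE mulgV.
- by have [_ _ ->] := gD (f2^-1 sigma); rewrite -tree_mulE mulgV.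
Qed.

Lemma diagJ_x g f0 f1 f2 : diag g f0 f1 f2 -> diag (g ^ gs_x) f1 f2 f0.
Proof.
move=> gD sigma; have [g0 g1 g2] := gD sigma.
have E11 : (1 + 1 = 2 :> 'F_3)%R by apply/eqP.
have E21 : (2 + 1 = 0 :> 'F_3)%R by apply/eqP.
by split; apply: tree_conjP; rewrite !gs_x_cons ?add0r ?E11 ?E21.
Qed.

Lemma diag_y : diag gs_y gs_x gs_x^-1 gs_y.
Proof. by []. Qed.

Lemma diag_t : diag gs_t gs_x gs_x gs_x.
Proof. by []. Qed.

Lemma gs_x3 : gs_x * gs_x * gs_x = 1.
Proof.
apply: tree_aut_eq => -[|s v] //; rewrite !tree_mulE !gs_x_cons.
by congr (_ :: _); elim/F3_ind: s; apply/eqP.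
Qed.

Lemma diag_1 : diag 1 1 1 1.
Proof. by []. Qed.

Lemma gs_t3 : gs_t * gs_t * gs_t = 1.
Proof.
have := diagM (diagM diag_t diag_t) diag_t; rewrite gs_x3.
by move/diag_eq; apply; apply: diag_1.
Qed.

Lemma gs_y3 : gs_y * gs_y * gs_y = 1.
Proof.
have := diagM (diagM diag_y diag_y) diag_y; rewrite gs_x3 => yD.
have xV3 : gs_x^-1 * gs_x^-1 * gs_x^-1 = 1.
  by rewrite -!invgM mulgA gs_x3 invg1.
apply: tree_aut_eq; elim=> // s v IHv; have [y0 y1 y2] := yD v.
by elim/F3_ind: s; rewrite ?y0 ?y1 ?y2 ?xV3 // IHv.
Qed.

Lemma gs_pred_x : gs_x \in gs_pred.
Proof. by apply/asboolP => H _; apply; rewrite !inE eqxx. Qed.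

Lemma gs_pred_y : gs_y \in gs_pred.
Proof. by apply/asboolP => H _; apply; rewrite !inE eqxx orbT. Qed.

(** Its sections are x y, 1 and y x^-1; hence gs_u and its conjugate by x have only
one letter below which both sections are nontrivial. *)
Definition gs_u : tree_aut := gs_y * gs_y ^ (gs_x * gs_x).

Lemma gs_x_conj_t : gs_x ^ gs_t^-1 = gs_x.
Proof.
apply/eqP; rewrite conjg_fix; apply/commgP/commuteV.
by apply: tree_aut_eq => -[|s v].
Qed.

(** The commutator on the right acts only below the third letter, by the commutator
of y x^-1 and x y; as y has order three, this is the commutator of y and x that
turns y into x y x^-1. *)
Lemma gs_y_conj_t : gs_y ^ gs_t^-1 = gs_y * [~ gs_u^-1, (gs_u ^ gs_x)^-1].
Proof.
have tV := diagV diag_t.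
have uD : diag gs_u (gs_x * gs_y) (gs_x^-1 * gs_x) (gs_y * gs_x^-1).
  rewrite /gs_u conjgM; exact: diagM diag_y (diagJ_x (diagJ_x diag_y)).
have vD := diagJ_x uD.
have uV := diagV uD; have vV := diagV vD.
apply: (diag_eq (diagM (diagV tV) (diagM diag_y tV))).
set w := gs_y * [~ _, _].
have : diag w _ _ _ :=
  diagM diag_y (diagM (diagV uV) (diagM (diagV vV) (diagM uV vV))).
rewrite {}/w; move: (gs_y * _) => w.
rewrite !(invgK, mulVg, mulgV, invg1, mulg1, mul1g) mulVKg.
congr (diag _ _ _ _).
have y2 : gs_y * gs_y = gs_y^-1 by apply/esym/mulg1_eq; rewrite mulgA gs_y3.
rewrite !invgM invgK !mulgA mulgVK gs_y3 mul1g -[_ / gs_y / gs_y]mulgA -invgM.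
by rewrite y2 invgK.
Qed.

Lemma gs_pred_conj_t g : g \in gs_pred -> g ^ gs_t^-1 \in gs_pred.
Proof.
have GS := generated_closed (pred2 gs_x gs_y).
have GV := group_closedV GS; have GM := group_closedM GS.
have GJ h k : h \in gs_pred -> k \in gs_pred -> h ^ k \in gs_pred.
  by move=> hG kG; rewrite conjgE !GM // GV.
have uG : gs_u \in gs_pred.
  by rewrite GM ?GJ ?GM ?gs_pred_x ?gs_pred_y.
move=> /asboolP gP.
apply: (gP (fun g => g ^ gs_t^-1 \in gs_pred)).
  split=> [|h k]; rewrite !unfold_in /= ?conj1g; first exact: GS.1.
  by rewrite conjMg conjVg => hG kG; apply: GS.2.
move=> h; rewrite !inE => /orP[] /eqP ->; rewrite unfold_in /=.
  by rewrite gs_x_conj_t gs_pred_x.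
rewrite gs_y_conj_t GM ?gs_pred_y //.
by rewrite commgEl GM ?GJ ?GV ?GJ ?gs_pred_x.
Qed.

End TwistedPair.

(** * Quotients by level stabilizers *)

Section Levels.
Local Open Scope group_scope.

Lemma tree_aut_rcons (g : tree_aut) (u : vertex) s :
  exists t, g (rcons u s) = rcons (g u) t.
Proof.
have [_ _ ga] := tree_autP g.
have [t [E|E]] : adjacent (g u) (g (rcons u s)) by apply/ga; exists s; left.
  by exists t.
have := congr1 size E; rewrite size_rcons !size_tree_aut size_rcons => /eqP.
by rewrite ltn_eqF // ltnW.
Qed.

Lemma tree_aut_take (g : tree_aut) k (v : vertex) : take k (g v) = g (take k v).
Proof.
elim/last_ind: v => [|u s IHu]; first by have [_ -> _] := tree_autP g.
have [lt_uk|le_ku] := ltnP (size u) k.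
  by rewrite !take_oversize // ?size_tree_aut size_rcons.
have [t ->] := tree_aut_rcons g u s.
by rewrite -!cats1 !takel_cat ?size_tree_aut.
Qed.

Lemma level_stab_fix n (g : gupta_sidki) (v : vertex) :
  g \in level_stab_pred (n + size v) -> val g v = v.
Proof.
move=> /forallP gP; pose w : vertex := v ++ nseq n (ord0 : alphabet).
have sw : size w == (n + size v)%N by rewrite size_cat size_nseq addnC.
have := congr1 (take (size v)) (eqP (gP (Tuple sw))).
by rewrite tree_aut_take take_size_cat.
Qed.

Lemma eq_quot_pi (G : groupType) (N : normal_subgroup G) (g h : G) :
  (\pi_(quotient_group N) g = \pi_(quotient_group N) h)%qT ->
  g^-1 * h \in nsub_pred N.
Proof. by move/eqmodP. Qed.

End Levels.

Section QuotientEpi.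
Variables (F G : groupType) (f : {multiplicative F -> G}).
Variable N : normal_subgroup G.
Hypothesis f_surj : forall g, exists w, f w = g.

Definition quot_epi_fun (w : F) : quotient_group N :=
  (\pi_(quotient_group N) (f w))%qT.

Lemma quot_epi_funM : {morph quot_epi_fun : u v / (u * v)%g}.
Proof. by move=> u v; rewrite /quot_epi_fun gmulfM; apply: pi_quot_mul. Qed.

HB.instance Definition _ :=
  isMultiplicative.Build F (quotient_group N) quot_epi_fun quot_epi_funM.

Lemma quot_epi_surj q : exists w, quot_epi_fun w = q.
Proof.
have [w wE] := f_surj (repr q); exists w.
by rewrite /quot_epi_fun wE reprK.
Qed.

Definition quot_epi : Epi F (quotient_group N) :=
  EpiOf (epi_fun := quot_epi_fun) quot_epi_surj.

End QuotientEpi.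

(** * Two generating pairs *)

Section GeneratingPairs.
Local Open Scope group_scope.

Definition gsX : gupta_sidki := exist _ gs_x gs_pred_x.
Definition gsY : gupta_sidki := exist _ gs_y gs_pred_y.
Definition gsY' : gupta_sidki :=
  exist _ (gs_y ^ gs_t^-1) (gs_pred_conj_t gs_pred_y).

Definition std_pair : F2 -> gupta_sidki :=
  free_lift (fun i : 'I_2 => if i == ord0 then gsX else gsY).
Definition twisted_pair : F2 -> gupta_sidki :=
  free_lift (fun i : 'I_2 => if i == ord0 then gsX else gsY').
HB.instance Definition _ := Multiplicative.on std_pair.
HB.instance Definition _ := Multiplicative.on twisted_pair.

Definition std_tree (w : F2) : tree_aut := val (std_pair w).
Lemma std_treeM : {morph std_tree : u v / u * v}.
Proof. by move=> u v; rewrite /std_tree gmulfM. Qed.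
HB.instance Definition _ := isMultiplicative.Build F2 tree_aut std_tree std_treeM.

Lemma std_tree_a : std_tree gen_a = gs_x.
Proof. by rewrite /std_tree /std_pair free_lift_gen. Qed.

Lemma std_tree_b : std_tree gen_b = gs_y.
Proof. by rewrite /std_tree /std_pair free_lift_gen. Qed.

Lemma twisted_pairE w : val (twisted_pair w) = std_tree w ^ gs_t^-1.
Proof.
have Ea : val (twisted_pair gen_a) = std_tree gen_a ^ gs_t^-1.
  by rewrite std_tree_a gs_x_conj_t /twisted_pair free_lift_gen.
have Eb : val (twisted_pair gen_b) = std_tree gen_b ^ gs_t^-1.
  by rewrite std_tree_b /twisted_pair free_lift_gen.
elim/F2_ind: w => [|u v IHu IHv||||] //.
- by rewrite !gmorph1 conj1g.
- by rewrite !gmulfM conjMg -IHu -IHv.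
- by rewrite !gmorphV conjVg -Ea.
- by rewrite !gmorphV conjVg -Eb.
Qed.

Lemma std_pair_surj (g : gupta_sidki) : exists w, std_pair w = g.
Proof.
have /asboolP gP := valP g.
suff /asboolP [w wE] : val g \in (fun h => `[< exists w, std_tree w = h >]).
  by exists w; apply: val_inj; apply: wE.
apply: gP => [|h].
  split=> [|h k]; first by apply/asboolP; exists 1; rewrite gmorph1.
  move=> /asboolP [u <-] /asboolP [v <-]; apply/asboolP.
  by exists (u * v^-1); rewrite gmulfM gmorphV.
rewrite !inE => /orP[] /eqP ->; apply/asboolP.
  by exists gen_a; rewrite std_tree_a.
by exists gen_b; rewrite std_tree_b.
Qed.

(** Conjugation by t is the square of conjugation by t^-1, so it maps G_3 into
itself and inverts the endomorphism of G_3 taking the first pair to the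
second. *)
Lemma twisted_pair_surj (g : gupta_sidki) : exists w, twisted_pair w = g.
Proof.
have tE : gs_t = gs_t^-1 * gs_t^-1.
  by apply: (mulgI (gs_t * gs_t)); rewrite -[in RHS]invgM mulgV gs_t3.
have gt : val g ^ gs_t \in gs_pred.
  by rewrite tE conjgM; do 2!apply: gs_pred_conj_t; apply: valP.
have [w wE] := std_pair_surj (exist (fun h : tree_aut => gs_pred h) _ gt).
exists w; apply: val_inj; rewrite twisted_pairE.
by rewrite /std_tree wE conjgK.
Qed.

Lemma portrait_tV :
  portrait gs_t^-1 0%R (fun=> -1)%R (fun=> 0)%R (fun=> 0)%R.
Proof.
have tVE (s : 'F_3) v : gs_t^-1 (s :: v) = s :: gs_x^-1 v.
  by apply: tree_invP; congr (_ :: _); apply: (tree_inv_funK gs_x).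
by move=> i j k; rewrite /v3 tVE gs_xV_cons; congr v3; ring.
Qed.

Lemma derived_coords_twisted :
  derived_coords (val (twisted_pair comm_ab)) (-1)%R 0%R 1%R 1%R.
Proof.
have cE : std_tree comm_ab = [~ std_tree gen_a, std_tree gen_b] := gmorphR _ _ _.
rewrite twisted_pairE cE std_tree_a std_tree_b.
exists (fun i => c_ga i + i)%R; last by split; apply/eqP.
move=> i j k; apply: tree_conjP.
by rewrite portrait_tV portrait_comm portrait_tV; congr v3; rewrite ?addr0; ring.
Qed.

End GeneratingPairs.

Theorem proposition1p2 (n : nat) (hn : (1 <= n)%N) :
  ~ Epi_transitive F2 (quotient_group (St (n + 3))).
Proof.
pose N := St (n + 3).
move=> /(_ (quot_epi N std_pair_surj) (quot_epi N twisted_pair_surj)) [tau tauE].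
have /eq_quot_pi := tauE comm_ab.
set sigma := aut_inv tau => /= stab.
have [l lE] := F2_commg_conj_prod (sigma gen_a) (sigma gen_b).
rewrite -gmorphR -/comm_ab in lE.
have two : (2 != 0 :> 'F_3)%R by [].
have := automorphism_moments two (autK tau) lE.
have := derived_coords_conj_prod l std_tree_a std_tree_b; rewrite -lE /=.
have eq3 v : size v = 3 ->
    std_tree (sigma comm_ab) v = val (twisted_pair comm_ab) v.
  move=> v3; have := level_stab_fix (v := v) (n := n).
  rewrite v3 => /(_ _ stab) fix_v.
  rewrite -[twisted_pair _](mulVKg (std_pair (sigma comm_ab))) [val _]gmulfM.
  by rewrite tree_mulE fix_v.
move=> /(derived_coords_uniq eq3) /(_ derived_coords_twisted).
(* Comparison with (-1, 0, 1, 1) gives moments 1, 0, 0, -1: nonzero covariance. *)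
set m := moment _ _; move=> [/oppr_inj -> /eqP E1 E2 E3].
move: E1 E2 E3; rewrite oppr_eq0 => /eqP -> E2; rewrite sub0r => /eqP.
rewrite eqr_oppLR => /eqP ->; rewrite mul0r mul1r => /eqP.
by [].
Qed.
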